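(* Let $g$ be the probability density on $(0,\infty)$ of the distance between two independent uniformly random points of a region $R$, with finite mean $\mathbb{E}[d]=\int_0^\infty t\,g(t)\,dt$. Let $\tilde G(s)=\int_0^\infty e^{-st}g(t)\,dt$ and, for $s\ge 0$, let $f(t\mid s)=g(t)e^{-st}/\tilde G(s)$ be the density of the length of an edge in the Waxman random graph with parameter $s$ on $R$. Then the Kullback–Leibler divergence satisfies $$\mathrm{KLD}\big(g(t)\,\big\|\,f(t\mid s)\big)=s\,\mathbb{E}[d]+\ln\tilde G(s).$$
   Context: $\mathrm{KLD}(g\,\|\,f)=\int_0^\infty g(t)\ln\frac{g(t)}{f(t)}\,dt$ (with the integrand taken as $0$ where $g(t)=0$). Waxman random graph: nodes are placed independently and uniformly at random in $R$, and each pair of nodes at distance $d$ is independently made an edge with probability $q e^{-sd}$, with $q\in(0,1]$, $s\ge0$. The case $s=0$ is the Gilbert–Erdős–Rényi random graph, whose link-length density is $g$; thus this quantity compares the link-length distributions of the two models. *)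

(* Defs.v *)
From HB Require Import structures.
From mathcomp Require Import all_boot all_order all_algebra.
From mathcomp Require Import all_classical all_reals all_analysis.
From mathcomp Require Import measurable_realfun.

Set Implicit Arguments.
Unset Strict Implicit.
Unset Printing Implicit Defensive.

Import Order.TTheory GRing.Theory Num.Theory.
Import numFieldNormedType.Exports.

Local Open Scope classical_set_scope.
Local Open Scope ring_scope.

Section region.
Context {R : realType} dT (T : measurableType dT).

(* The ambient space is any metric space with a sigma-algebra making the
   distance jointly measurable: for a separable space, e.g. a Euclidean one,
   the Borel sigma-algebra qualifies. *)
Record is_metric (dist : T -> T -> R) : Prop := {
  dist_refl : forall x, dist x x = 0 ;
  dist_eq0 : forall x y, dist x y = 0 -> x = y ;
  dist_sym : forall x y, dist x y = dist y x ;
  dist_triangle : forall y x z, dist x z <= dist x y + dist y z ;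
  dist_measurable : measurable_fun setT (fun p : T * T => dist p.1 p.2) }.

(* [vol] is the volume of the ambient space, e.g. Lebesgue measure. *)
Definition is_region (vol : {measure set T -> \bar R}) (D : set T) : Prop :=
  measurable D /\ (0 < vol D < +oo)%E.

Context d (Omega : measurableType d) (P : probability Omega R).

Definition uniform_on (vol : {measure set T -> \bar R}) (D : set T)
    (X : {RV P >-> T}) : Prop :=
  forall A, measurable A -> P (X @^-1` A) = (vol (A `&` D) / vol D)%E.

Definition independent_points (X Y : {RV P >-> T}) : Prop :=
  forall A B, measurable A -> measurable B ->
    P (X @^-1` A `&` Y @^-1` B) = (P (X @^-1` A) * P (Y @^-1` B))%E.

(* [E] is the event that nodes at [X] and [Y] are joined in the Waxman graph:
   given their positions, it has probability q e^(-s dist(X, Y)). *)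
Definition waxman_edge (dist : T -> T -> R) (X Y : {RV P >-> T}) (q s : R)
    (E : set Omega) : Prop :=
  measurable E /\
  forall B : set (T * T), measurable B ->
    P (E `&` [set w | B (X w, Y w)]) =
    (\int[P]_(w in [set w | B (X w, Y w)])
       (q * expR (- (s * dist (X w) (Y w))))%:E)%E.

End region.

Section density.
Context {R : realType}.

(* [g] is a density on (0, +oo) of the random variable [L]; its values on
   ]-oo, 0] are irrelevant. *)
Definition is_pos_density d (Omega : measurableType d)
    (P : probability Omega R) (L : Omega -> R) (g : R -> R) : Prop :=
  [/\ measurable_fun (`]0, +oo[ : set R) g,
      forall t, 0 < t -> 0 <= g t &
      forall A : set R, measurable A ->
        P (L @^-1` A) =
        (\int[lebesgue_measure]_(t in A `&` `]0%R, +oo[) (g t)%:E)%E].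

Definition mean (g : R -> R) : \bar R :=
  (\int[lebesgue_measure]_(t in `]0%R, +oo[) (t * g t)%:E)%E.

Definition laplace (g : R -> R) (s : R) : R :=
  \int[lebesgue_measure]_(t in `]0%R, +oo[) (expR (- (s * t)) * g t).

Definition waxman_density (g : R -> R) (s t : R) : R :=
  g t * expR (- (s * t)) / laplace g s.

(* By the conventions of \bar R the integrand is +oo where f vanishes and g
   does not. *)
Definition kld (g f : R -> R) : \bar R :=
  (\int[lebesgue_measure]_(t in `]0%R, +oo[)
    if g t == 0%R then 0 else (g t)%:E * lne ((g t)%:E / (f t)%:E))%E.

End density.

Section waxman_density.
Context {R : realType} d (Omega : measurableType d) (P : probability Omega R).
Local Notation leb := (@lebesgue_measure R).
Local Notation pos := (`]0%R, +oo[%classic : set R).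

Lemma integral_pos_density (L : {RV P >-> measurableTypeR R}) (g phi : R -> R) (A : set R) :
  is_pos_density P L g -> measurable A ->
  measurable_fun setT phi -> (forall t, 0 <= phi t <= 1) ->
  (\int[P]_(w in L @^-1` A) (phi (L w))%:E =
   \int[leb]_(t in A `&` pos) (phi t * g t)%:E)%E.
Proof.
move=> [mg g0 gE] mA mphi phi01.
pose nu : probability (measurableTypeR R) R := distribution P L.
have mp : measurable pos by exact: measurable_itv.
pose G : R -> \bar R := ((EFin \o g) \_ pos).
have mG : measurable_fun (setT : set R) G.
  by apply/(measurable_restrictT _ _).1 => //; exact/measurable_EFinP.
have nuE B : measurable B -> nu B = (\int[leb]_(t in B) G t)%E.
  move=> mB; transitivity (P (L @^-1` B)); first by [].
  by rewrite gE// integral_mkcondr.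
have nuleb : nu `<< leb.
  apply/null_content_dominatesP => B mB B0.
  rewrite nuE// null_set_integral//.
  exact: measurable_funTS.
have mL : measurable_fun setT L by exact: measurable_funP.
rewrite -(ge0_integral_pushforward mL P (f := EFin \o phi))//; last 2 first.
- by apply/measurable_EFinP; exact: measurable_funTS.
- by move=> y _ /=; rewrite lee_fin; case/andP: (phi01 y).
rewrite -[LHS]/(\int[nu]_(x in A) (phi x)%:E)%E.
have iphi : nu.-integrable (A : set (measurableTypeR R)) (EFin \o phi).
  apply: measurable_bounded_integrable => //.
  - by rewrite (le_lt_trans (probability_le1 _ _))// ltry.
  - exact: measurable_funTS.
  - exists 1; split => // M M1 x _ /=; have /andP[? p1] := phi01 x.
    by rewrite ger0_norm// (le_trans p1)// ltW.
rewrite -(@Radon_Nikodym_change_of_variables _ (measurableTypeR R) _ nu leb nuleb _ _ mA iphi)//.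
rewrite integral_mkcondr.
have iRN := @Radon_Nikodym_integrable _ (measurableTypeR R) _ (charge_of_finite_measure nu) leb nuleb.
apply: ae_eq_integral => //.
- apply: emeasurable_funM; first exact: measurable_int iphi.
  by apply: measurable_funTS; exact: measurable_int iRN.
- apply: measurable_funTS; apply/(measurable_restrictT _ _).1 => //.
  apply/measurable_EFinP; apply: measurable_funM => //.
  exact: measurable_funTS.
have := @integral_ae_eq _ _ _ leb setT measurableT G _ iRN mG.
have -> : (fun x => ((phi x * g x)%:E)%E) \_ pos = ((EFin \o phi) \* G)%E.
  apply/funext => x; rewrite /G /patch/=; case: ifPn => _.
    by rewrite EFinM.
  by rewrite mule0.
move=> h; apply: (@filterS _ _ _ _ _ _ (h _)) => [x /= /(_ I) -> //|B _ mB].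
by rewrite -nuE// -Radon_Nikodym_integral.
Qed.


Lemma laplace_gt0 (L : {RV P >-> measurableTypeR R}) (g : R -> R) (s : R) :
  is_pos_density P L g -> 0 <= s ->
  (\int[leb]_(t in pos) (expR (- (s * t)) * g t)%:E = (laplace g s)%:E)%E
  /\ 0 < laplace g s.
Proof.
move=> [mg g0 gE] s0.
have mp : measurable pos by exact: measurable_itv.
pose f t := expR (- (s * t)) * g t.
have f0 t : pos t -> 0 <= f t.
  by rewrite /= in_itv/= andbT => t0; rewrite mulr_ge0 ?expR_ge0 ?g0.
have mf : measurable_fun pos f.
  apply: measurable_funM => //; apply: measurableT_comp => //.
  by apply: measurableT_comp => //; exact: measurable_funM.
have g1 : (\int[leb]_(t in pos) (g t)%:E = 1)%E.
  by rewrite -[pos]setTI -gE// preimage_setT probability_setT.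
have I0 : (0 <= \int[leb]_(t in pos) (f t)%:E)%E.
  by apply: integral_ge0 => t pt; rewrite lee_fin f0.
have I1 : (\int[leb]_(t in pos) (f t)%:E <= 1)%E.
  rewrite -g1; apply: (@ge0_le_integral _ _ _ leb pos mp (EFin \o f) (EFin \o g)).
  - by move=> t pt; rewrite lee_fin f0.
  - exact/measurable_EFinP.
  - exact/measurable_EFinP.
  - move=> t; rewrite /= in_itv/= andbT => t0; rewrite lee_fin ler_piMl ?g0//.
    by rewrite -expR0 ler_expR oppr_le0 mulr_ge0// ltW.
have If : (\int[leb]_(t in pos) (f t)%:E = (laplace g s)%:E)%E.
  rewrite /laplace /Rintegral fineK// ge0_fin_numE//.
  by rewrite (le_lt_trans I1)// ltry.
split=> //; rewrite lt_neqAle -lee_fin -If I0 andbT.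
apply/eqP => l0.
have [+ _] := ae_eq_integral_abs leb mp ((measurable_EFinP _ _).2 mf).
have -> : (\int[leb]_(x in pos) `|(EFin \o f) x| = 0)%E.
  transitivity (\int[leb]_(t in pos) (f t)%:E)%E; last by rewrite If -l0.
  apply: eq_integral => t /[!inE] pt; have ft0 := f0 _ pt.
  by rewrite gee0_abs// lee_fin.
move=> /(_ erefl) f_ae0.
have : (\int[leb]_(t in pos) (g t)%:E = 0)%E.
  rewrite -(integral0 leb pos); apply: ae_eq_integral => //.
    exact/measurable_EFinP.
  apply: filterS f_ae0 => t /= + pt => /(_ pt) /eqP.
  by rewrite eqe /f mulf_eq0 gt_eqF ?expR_gt0//= => /eqP ->.
by rewrite g1 => /eqP; rewrite onee_eq0.
Qed.

(* [waxman_density g s] is the density of the link length conditionally on the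
   link being present, whatever q is. *)
Lemma waxman_edge_density dT (T : measurableType dT) (dist : T -> T -> R)
    (X Y : {RV P >-> T}) (g : R -> R) (q s : R) (E : set Omega) (A : set R) :
  is_metric dist -> is_pos_density P (fun w => dist (X w) (Y w)) g ->
  0 < q <= 1 -> 0 <= s -> waxman_edge dist X Y q s E -> measurable A ->
  (P (E `&` [set w | A (dist (X w) (Y w))]) / P E =
   \int[leb]_(t in A `&` pos) (waxman_density g s t)%:E)%E.
Proof.
move=> mdist gd /andP[q0 q1] s0 [mE EE] mA.
pose L w := dist (X w) (Y w).
have mXY : measurable_fun setT (fun w => (X w, Y w)).
  by apply: measurable_fun_pair; exact: measurable_funP.
have mL : measurable_fun setT L.
  exact: (measurableT_comp (dist_measurable mdist) mXY).
pose L' : {RV P >-> measurableTypeR R} := 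
  HB.pack L (@isMeasurableFun.Build _ _ Omega (measurableTypeR R) L mL).
have gd' : is_pos_density P L' g by [].
pose phi (t : R) := q * expR (- (s * `|t|)).
have mphi : measurable_fun (setT : set R) phi.
  apply: measurable_funM => //; apply: measurableT_comp => //.
  by apply: measurableT_comp => //; apply: measurable_funM => //;
    exact: normr_measurable.
have phi01 (t : R) : 0 <= phi t <= 1.
  rewrite mulr_ge0 ?expR_ge0 ?(ltW q0)//=.
  rewrite mulr_ile1 ?(ltW q0) ?expR_ge0// -expR0 ler_expR oppr_le0.
  by rewrite mulr_ge0.
have L0 w : 0 <= L w.
  have := dist_triangle mdist (Y w) (X w) (X w).
  rewrite (dist_sym mdist (Y w)) (dist_refl mdist) -/(L w).
  by rewrite -mulr2n pmulrn_lge0.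
have PE B : measurable B ->
    (P (E `&` [set w | B (L w)]) =
     q%:E * \int[leb]_(t in B `&` pos) (expR (- (s * t)) * g t)%:E)%E.
  move=> mB.
  have mdB : measurable [set p : T * T | B (dist p.1 p.2)].
    by rewrite -[X in measurable X]setTI; exact: (dist_measurable mdist).
  rewrite (EE _ mdB)/=.
  transitivity (\int[P]_(w in L' @^-1` B) (phi (L' w))%:E)%E.
    by apply: eq_integral => w _; rewrite /phi ger0_norm ?L0.
  rewrite (integral_pos_density gd')//.
  have mBp : measurable (B `&` pos) by exact: measurableI.
  have [mg g0 _] := gd.
  rewrite -ge0_integralZl//.
  - apply: eq_integral => t /[!inE] -[_]/=; rewrite in_itv/= andbT => t0.
    by rewrite /phi gtr0_norm// -EFinM mulrA.
  - apply/measurable_EFinP; apply: measurable_funM.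
      apply: measurable_funTS; apply: measurableT_comp => //.
      by apply: measurableT_comp => //; exact: measurable_funM.
    exact: measurable_funS mg.
  - move=> t [_]/=; rewrite in_itv/= andbT => t0.
    by rewrite lee_fin mulr_ge0 ?expR_ge0 ?g0.
  - by rewrite lee_fin ltW.
have [lE l0] := laplace_gt0 gd' s0.
have -> : (P E = (q * laplace g s)%:E)%E.
  have := PE _ measurableT; rewrite setIT setTI lE => ->.
  by rewrite -EFinM.
rewrite PE// inver gt_eqF ?mulr_gt0//.
have [mg g0 _] := gd.
have mAp : measurable (A `&` pos) by exact: measurableI.
have mf : measurable_fun (A `&` pos) (fun t => expR (- (s * t)) * g t).
  apply: measurable_funM; last exact: measurable_funS mg.
  apply: measurable_funTS; apply: measurableT_comp => //.
  by apply: measurableT_comp => //; exact: measurable_funM.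
have f0 t : (A `&` pos) t -> (0 <= (expR (- (s * t)) * g t)%:E)%E.
  move=> [_]/=; rewrite in_itv/= andbT => t0.
  by rewrite lee_fin mulr_ge0 ?expR_ge0 ?g0.
rewrite muleAC -EFinM -ge0_integralZl//.
- apply: eq_integral => t _; rewrite -EFinM /waxman_density; congr EFin.
  have -> : q / (q * laplace g s) = (laplace g s)^-1.
    by rewrite invfM mulrA mulfV ?gt_eqF// mul1r.
  by rewrite mulrC [expR _ * _]mulrC.
- exact/measurable_EFinP.
- by rewrite lee_fin mulr_ge0 ?invr_ge0 ?mulr_ge0 ?ltW.
Qed.

End waxman_density.

(* Main.v *)
Require Import Defs.
From HB Require Import structures.
From mathcomp Require Import all_boot all_order all_algebra.
From mathcomp Require Import all_classical all_reals all_analysis.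
From mathcomp Require Import measurable_realfun.

(** The two densities differ by an exponential factor only: wherever [g t] is
nonzero, [g t / f t = exp (s t) G], with [G] the Laplace transform of [g] at
[s], so the logarithm is the affine function [s t + ln G]
([lne_waxman_ratio]).  The divergence is therefore the expectation of
[s t + ln G] under [g], and linearity of the integral splits it into [s] times
the mean plus [ln G] times the total mass of [g], which is one
([kld_waxman_density], [pos_density_mass1]).

The term [ln G] may be negative (it is at most zero), so linearity needs
integrability rather than mere nonnegativity: this is where the finite mean is
used.  That [G] is positive, so that its logarithm and the quotients make sense,
is [laplace_gt0]: a density of mass one times a positive function cannot integrate
to zero. *)

Set Implicit Arguments.
Unset Strict Implicit.
Unset Printing Implicit Defensive.

Import Order.TTheory GRing.Theory Num.Theory.
Import numFieldNormedType.Exports.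

Local Open Scope classical_set_scope.
Local Open Scope ring_scope.

Section kld_waxman.
Context {R : realType}.
Local Notation leb := (@lebesgue_measure R).
Local Notation pos := (`]0%R, +oo[%classic : set R).

Lemma pos_density_mass1 d (Omega : measurableType d) (P : probability Omega R)
    (L : Omega -> R) (g : R -> R) :
  is_pos_density P L g -> (\int[leb]_(t in pos) (g t)%:E = 1)%E.
Proof.
by move=> [_ _ gE]; rewrite -[pos]setTI -gE// preimage_setT probability_setT.
Qed.

(** The hypothesis [g t != 0] makes [f t] nonzero, so that the division is the
real one and the factor [g t] cancels. *)
Lemma lne_waxman_ratio (g : R -> R) (s t : R) :
  0 < laplace g s -> g t != 0 ->
  (lne ((g t)%:E / (waxman_density g s t)%:E)
   = (s * t + ln (laplace g s))%:E)%E.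
Proof.
move=> l0 gt0.
have e0 : expR (- (s * t)) != 0 by rewrite gt_eqF ?expR_gt0.
have w0 : waxman_density g s t != 0.
  by rewrite /waxman_density !mulf_neq0// invr_neq0// gt_eqF.
rewrite inver (negbTE w0) -EFinM.
have -> : g t / waxman_density g s t = expR (s * t) * laplace g s.
  rewrite /waxman_density -[s * t in RHS]opprK [in RHS]expRN !invfM invrK.
  by rewrite !mulrA mulfV// mul1r.
rewrite lne_EFin ?mulr_gt0 ?expR_gt0//.
by rewrite lnM ?posrE ?expR_gt0// expRK.
Qed.

Lemma ge0_integrable_pos (f : R -> R) :
  measurable_fun pos f -> (forall t, pos t -> 0 <= f t) ->
  (\int[leb]_(t in pos) (f t)%:E < +oo)%E ->
  leb.-integrable pos (EFin \o f).
Proof.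
move=> mf f0 foo; apply/integrableP; split; first exact/measurable_EFinP.
apply: le_lt_trans foo; rewrite le_eqVlt; apply/predU1l.
apply: eq_integral => t /[!inE] pt.
by rewrite gee0_abs//= lee_fin f0.
Qed.

(** Integrating the affine log-ratio against [g]; the convention at the zeros
of [g] agrees with the formula, both being zero there. *)
Lemma kld_waxman_density (g : R -> R) (s : R) :
  measurable_fun pos g -> (forall t, 0 < t -> 0 <= g t) ->
  (\int[leb]_(t in pos) (g t)%:E = 1)%E ->
  (mean g < +oo)%E -> 0 < laplace g s ->
  (kld g (waxman_density g s) = s%:E * mean g + (ln (laplace g s))%:E)%E.
Proof.
move=> mg g0 g1 moo l0.
have mp : measurable pos by exact: measurable_itv.
have ig : leb.-integrable pos (EFin \o g).
  apply: ge0_integrable_pos => //; last by rewrite g1 ltry.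
  by move=> t; rewrite /= in_itv/= andbT; exact: g0.
have itg : leb.-integrable pos (EFin \o (fun t => t * g t)).
  apply: ge0_integrable_pos => //; first exact: measurable_funM.
  by move=> t; rewrite /= in_itv/= andbT => t0; rewrite mulr_ge0 ?g0 ?ltW.
transitivity (\int[leb]_(t in pos) (s%:E * (t * g t)%:E
                 + (ln (laplace g s))%:E * (g t)%:E))%E.
  apply: eq_integral => t _.
  have [->|gt0] := eqVneq (g t) 0; first by rewrite mulr0 !mule0 adde0.
  rewrite lne_waxman_ratio// -!EFinM -EFinD; congr EFin.
  by rewrite mulrDr mulrC [g t * ln _]mulrC mulrA.
rewrite integralD//=; [|exact: integrableZl|exact: integrableZl].
by rewrite !integralZl//= g1 mule1.
Qed.

End kld_waxman.

Theorem mainTheorem3 (R : realType) (dT : measure_display)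
    (T : measurableType dT) (dist : T -> T -> R)
    (vol : {measure set T -> \bar R}) (D : set T)
    (d : measure_display) (Omega : measurableType d) (P : probability Omega R)
    (X Y : {RV P >-> T}) (g : R -> R) (s : R) :
  is_metric dist ->
  is_region vol D ->
  uniform_on vol D X -> uniform_on vol D Y -> independent_points X Y ->
  is_pos_density P (fun w => dist (X w) (Y w)) g ->
  (mean g < +oo)%E ->
  0 <= s ->
  kld g (waxman_density g s) = (s%:E * mean g + (ln (laplace g s))%:E)%E.
Proof.
move=> mdist _ _ _ _ gd moo s0.
(* [laplace_gt0] is about a bundled random variable, so the distance is first
   packed with its measurability. *)
have mXY : measurable_fun setT (fun w => (X w, Y w)).
  by apply: measurable_fun_pair; exact: measurable_funP.
have mL : measurable_fun setT (fun w => dist (X w) (Y w)).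
  exact: (measurableT_comp (dist_measurable mdist) mXY).
pose L : {RV P >-> measurableTypeR R} :=
  HB.pack (fun w => dist (X w) (Y w))
    (@isMeasurableFun.Build _ _ Omega (measurableTypeR R) _ mL).
have [_ l0] := @laplace_gt0 _ _ _ P L g s gd s0.
have [mg g0 _] := gd.
exact: kld_waxman_density mg g0 (pos_density_mass1 gd) moo l0.
Qed.
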